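(* For all integers $n\ge 0$, $$c\phi_{18}(6n+5)\equiv 0\pmod{8}.$$
   Context: For a positive integer $k$ and an integer $n\ge 0$, $c\phi_k(n)$ denotes the number of $k$-colored generalized Frobenius partitions of $n$ (Andrews): two-rowed arrays $\begin{pmatrix} a_1 & a_2 & \cdots & a_r\\ b_1 & b_2 & \cdots & b_r\end{pmatrix}$ (with $r\ge 0$) in which every entry is a non-negative integer carrying one of $k$ colors, no integer occurs twice in the same color in the same row, each row is arranged in non-increasing order (equal integers being ordered by a fixed order on colors, so that a row is just a set of $r$ colored non-negative integers), and $n=r+\sum_{j=1}^r(a_j+b_j)$ (colors do not contribute to the sum). Equivalently, $\sum_{n\ge0}c\phi_k(n)q^n$ is the coefficient of $z^0$ in $\prod_{j\ge 0}(1+zq^{j+1})^k(1+z^{-1}q^{j})^k$. *)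

(* Defs.v *)
From mathcomp Require Import all_boot finmap.

Set Implicit Arguments.
Unset Strict Implicit.
Unset Printing Implicit Defensive.

Local Open Scope fset_scope.
Local Open Scope nat_scope.

(* An entry x stands for the integer x.1 in the colour x.2. The entries of a
   row are pairwise distinct and listed in a fixed order, so a row is the same
   as the finite set of its entries; p.1 is the top row, p.2 the bottom row. *)
Definition frobenius_array (k : nat) : Type :=
  ({fset nat * 'I_k} * {fset nat * 'I_k})%type.

Definition row_sum (k : nat) (A : {fset nat * 'I_k}) : nat :=
  \sum_(x <- A) x.1.

Definition is_gfp (k n : nat) (p : frobenius_array k) : bool :=
  (#|` p.1| == #|` p.2|) && (n == #|` p.1| + (row_sum p.1 + row_sum p.2)).

Definition entries (k n : nat) : {fset nat * 'I_k} :=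
  [fset i in iota 0 n.+1] `*` [fset c in 'I_k].

(* The bound n on the entries only makes the set finite: see mem_gfps. *)
Definition gfps (k n : nat) : {fset {fset nat * 'I_k} * {fset nat * 'I_k}} :=
  [fset p in fpowerset (entries k n) `*` fpowerset (entries k n)
     | is_gfp n p].

Lemma row_sum_entries (k n : nat) (A : {fset nat * 'I_k}) :
  row_sum A <= n -> A `<=` entries k n.
Proof.
move=> An; apply/fsubsetP => x xA.
rewrite in_fsetM !in_fset; apply/andP; split; last by [].
have : x.1 \in iota 0 n.+1; last by [].
rewrite mem_iota /= ltnS; apply: (leq_trans _ An).
by rewrite /row_sum (big_rem x) //= leq_addr.
Qed.

Lemma mem_gfps (k n : nat) (p : frobenius_array k) :
  (p \in gfps k n) = is_gfp n p.
Proof.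
rewrite !inE /=; apply: andb_idl => /andP[_ /eqP ->].
rewrite !fpowersetE !row_sum_entries //.
  by rewrite addnA leq_addl.
by rewrite addnCA leq_addr.
Qed.

Definition cphi (k n : nat) : nat := #|` gfps k n|.

(* Main.v *)
Require Import Defs.
From mathcomp Require Import all_boot.
From mathcomp Require Import all_algebra finmap zify ring.

(**
With q = h^2, the generating function of cphi_k is the coefficient of z^0 in the
k-th power of prod_j (1 + z h^(2j+1)) (1 + h^(2j+1) / z). By the Jacobi triple
product this is theta(z, h)^k / E(q)^k, where theta(z, h) = sum_m z^m h^(m^2)
and E(q) = prod_j (1 - q^j).
Squaring commutes with (z, h) -> (z^2, h^2) modulo 2, so modulo 8 the 18th power
of theta(z, h) is theta(z, h)^2 theta(z^4, h^4)^4. As the even coefficients of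
theta(z, h)^2 are monomials times phi(q) = sum_d q^(d^2), this gives
  E(q)^2 E(q^2)^8 C = phi(q) G    (mod 8),
where C is the generating function of cphi_18 and G is a series in q^2 with
G = 1 (mod 2). By Gauss, phi(-q) E(q^2) = E(q)^2, hence
  phi(q) phi(-q) E(q^2)^9 C = phi(q)^2 G.
Since phi(q) phi(-q) is even and is 1 modulo 4, the odd part of C is
4 S / E(q^2)^9, with S the sum of q^(d^2) over odd d > 0. Finally
psi(q^2) = sum_(m >= 0) q^(m(m+1)) = E(q^2)^3 (mod 2) turns this into
4 q psi(q^2), and 6n + 5 = m(m+1) + 1 is impossible modulo 3.

Power series truncated at order M in q are modelled by elements of a ring in
which h^(2M) = 0; the power z^M shifts Laurent polynomials to polynomials.
*)

Set Implicit Arguments.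
Unset Strict Implicit.
Unset Printing Implicit Defensive.

Import GRing.Theory.
Local Open Scope ring_scope.

(** * The finite Jacobi triple product *)

(** Gaussian binomial coefficients by the q-Pascal rule, which needs no division. *)
Fixpoint qbin (R : comNzRingType) (q : R) (n k : nat) : R :=
  match n, k with
  | _, 0 => 1
  | 0, _.+1 => 0
  | n'.+1, k'.+1 => qbin q n' k' + q ^+ k'.+1 * qbin q n' k'.+1
  end.

Definition qfact (R : comNzRingType) (q : R) (n : nat) : R :=
  \prod_(j < n) (1 - q ^+ j.+1).

(** The inverse of [qfact q n] when [q ^+ M = 0], as a product of geometric series. *)
Definition qfact_inv (R : comNzRingType) (q : R) (M n : nat) : R :=
  \prod_(j < n) \sum_(i < M) (q ^+ j.+1) ^+ i.

(** The factors 1 + h^(2j+1)/z are multiplied by z to stay polynomial, so the coefficient of index i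
    is that of z^(i-b). *)
Definition jacobi_prod (R : comNzRingType) (h : R) (a b : nat) : {poly R} :=
  \prod_(j < a) (1 + h ^+ (2 * j + 1) *: 'X) *
  \prod_(j < b) ('X + (h ^+ (2 * j + 1))%:P).

(** The square of the integer i - b: one of the two truncated differences is always zero. *)
Definition sqdist (i b : nat) : nat := ((i - b) ^ 2 + (b - i) ^ 2)%N.

Lemma sqdistE i b : (sqdist i b + 2 * (i * b) = i * i + b * b)%N.
Proof.
rewrite /sqdist -!mulnn.
by case: (leqP i b) => [|/ltnW] /subnK <-; rewrite addnK; nia.
Qed.

Section QBinomial.
Variables (R : comNzRingType) (q : R).

Lemma qbin0 n : qbin q n 0 = 1.
Proof. by case: n. Qed.

Lemma qbin_small n k : (n < k)%N -> qbin q n k = 0.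
Proof.
elim: n k => [|n IHn] [|k] //= ltnk.
by rewrite !IHn ?mulr0 ?addr0 //; lia.
Qed.

(** The second q-Pascal rule. Extending the first product of [jacobi_prod] calls for it, while the
    rule defining [qbin] serves the second product. *)
Lemma qbinSl n k : (k <= n)%N ->
  qbin q n.+1 k.+1 = qbin q n k.+1 + q ^+ (n - k) * qbin q n k.
Proof.
elim: n k => [|n IHn] k lekn.
  by case: k lekn => //= _; rewrite mulr0 addr0 add0r mul1r.
have [->|ltkn] := eqVneq k n.+1.
  rewrite subnn [LHS]/= -/(qbin q n.+1 n.+1) -/(qbin q n.+1 n.+2).
  by rewrite !(@qbin_small _ n.+2) // mulr0 mul1r addrC.
have lekn' : (k <= n)%N by lia.
have -> : qbin q n.+2 k.+1 = qbin q n.+1 k + q ^+ k.+1 * qbin q n.+1 k.+1 by [].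
rewrite [in LHS](IHn k) //.
have -> : qbin q n.+1 k.+1 = qbin q n k + q ^+ k.+1 * qbin q n k.+1 by [].
case: k lekn lekn' ltkn => [|k] lekn lekn' ltkn.
  by rewrite !qbin0 !subn0 [q ^+ n.+1]exprS; ring.
rewrite [in LHS]IHn; last by lia.
have -> : (n.+1 - k.+1 = n - k)%N by lia.
have -> : (n - k = (n - k.+1).+1)%N by lia.
have -> : qbin q n.+1 k.+1 = qbin q n k + q ^+ k.+1 * qbin q n k.+1 by [].
rewrite [q ^+ k.+2]exprS [q ^+ (n - k.+1).+1]exprS; ring.
Qed.

Lemma qfactS n : qfact q n.+1 = qfact q n * (1 - q ^+ n.+1).
Proof. by rewrite /qfact big_ord_recr. Qed.

Lemma qbin_qfact n k :
  (k <= n)%N -> qbin q n k * qfact q k * qfact q (n - k) = qfact q n.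
Proof.
elim: n k => [|n IHn] [|k] lekn.
- by rewrite /qfact !big_ord0 !mul1r.
- by [].
- by rewrite qbin0 subn0 /qfact big_ord0 !mul1r.
have -> : qbin q n.+1 k.+1 = qbin q n k + q ^+ k.+1 * qbin q n k.+1 by [].
rewrite subSS !mulrDl.
have [->|neqkn] := eqVneq k n.
  rewrite (@qbin_small n n.+1) // mulr0 !mul0r addr0 !qfactS.
  rewrite -[in RHS](IHn n) //.
  by ring.
have E : (n - k = (n - k.+1).+1)%N by lia.
transitivity (qbin q n k * qfact q k * qfact q (n - k) * (1 - q ^+ k.+1) +
  q ^+ k.+1 * (qbin q n k.+1 * qfact q k.+1 * qfact q (n - k.+1)) *
  (1 - q ^+ (n - k))).
  by rewrite [qfact q k.+1]qfactS {2 4}E qfactS -E; ring.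
rewrite !IHn; [|lia..].
rewrite qfactS; have -> : q ^+ n.+1 = q ^+ k.+1 * q ^+ (n - k).
  by rewrite -exprD; congr (_ ^+ _); lia.
by ring.
Qed.

End QBinomial.

Lemma rmorph_qbin (R S : comNzRingType) (f : {rmorphism R -> S}) (q : R) n k :
  f (qbin q n k) = qbin (f q) n k.
Proof.
elim: n k => [|n IHn] [|k] /=; rewrite ?rmorph0 ?rmorph1 //.
by rewrite rmorphD rmorphM rmorphXn !IHn.
Qed.

Lemma coef_finite_jacobi (R : comNzRingType) (h : R) (a b i : nat) :
  (jacobi_prod h a b)`_i = h ^+ sqdist i b * qbin (h ^+ 2) (a + b) i.
Proof.
rewrite /jacobi_prod; elim: a i => [|a IHa] i.
  rewrite big_ord0 mul1r add0n.
  elim: b i => [|b IHb] i.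
    rewrite big_ord0 coef1; case: i => [|i] /=.
      by rewrite expr0 mul1r.
    by rewrite mulr0.
  rewrite big_ord_recr /= mulrDr coefD coefMX coefMC !IHb.
  case: i => [|i] /=.
    rewrite add0r !qbin0 !mulr1 -exprD; congr (_ ^+ _).
    have := sqdistE 0 b; have := sqdistE 0 b.+1; lia.
  have -> : sqdist i.+1 b.+1 = sqdist i b by rewrite /sqdist !subSS.
  rewrite -[X in _ + X]mulrA [_ * h ^+ (2 * b + 1)]mulrC mulrA -exprD mulrDr.
  rewrite mulrA -exprM -exprD; congr (_ + _ ^+ _ * _).
  by have := sqdistE i b; have := sqdistE i.+1 b; lia.
rewrite big_ord_recr /= [X in X * _]mulrC -mulrA mulrDl mul1r coefD IHa.
rewrite -scalerAl coefZ coefXM.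
case: i => [|i] /=; first by rewrite !qbin0 mulr0 addr0.
rewrite IHa.
have [lt|le] := ltnP (a + b) i.
  by rewrite !qbin_small ?(mulr0, addr0) //; lia.
have := @qbinSl R (h ^+ 2) (a + b) i le => /= ->.
rewrite mulrDr; congr (_ + _).
rewrite !mulrA -exprM -!exprD; congr (_ ^+ _ * _).
by have := sqdistE i b; have := sqdistE i.+1 b; lia.
Qed.

Section Truncated.
Variables (R : comNzRingType) (q : R) (M : nat).
Hypothesis qM : q ^+ M = 0.

Lemma qfactK n : qfact q n * qfact_inv q M n = 1.
Proof.
rewrite /qfact -big_split /= big1 // => j _.
have := subrX1 (q ^+ j.+1) M; rewrite exprAC qM expr0n /=.
by move=> E; rewrite -[1 - _]opprB mulNr -E sub0r opprK.
Qed.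

Lemma mul_qfact_stable x w v :
  x * q ^+ w.+1 = 0 -> (w <= v)%N -> x * qfact q v = x * qfact q w.
Proof.
move=> xw /subnKC <-; elim: (v - w)%N => [|d IHd]; first by rewrite addn0.
rewrite addnS qfactS mulrA IHd mulrBr mulr1.
have -> : (w + d).+1 = (w.+1 + d)%N by [].
by rewrite -mulrA [_ * (_ ^+ _)]mulrC exprD !mulrA xw !mul0r subr0.
Qed.

(** Truncated form of the convergence of [qbin] to 1/E(q). Multiplication by [x] trivialises all
    factors of index beyond [w], so every q-factorial in [qbin_qfact] becomes [qfact q M]. *)
Lemma qbin_limit x w v k :
  (w <= M <= v)%N -> x * q ^+ w.+1 = 0 -> k = w \/ k = v ->
  qfact q M * (x * qbin q (w + v) k) = x.
Proof.
move=> /andP[wM Mv] xw kwv.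
have Ey := qfactK M; set y := qfact_inv q M M in Ey.
have q1 : 1 * q ^+ M.+1 = 0 by rewrite exprS qM !mulr0.
have Ev u : (M <= u)%N -> qfact q u = qfact q M.
  by move=> Mu; rewrite -[LHS]mul1r (mul_qfact_stable q1 Mu) mul1r.
have En : qbin q (w + v) k * qfact q w * qfact q v = qfact q M.
  rewrite -(Ev (w + v)%N); last by lia.
  case: kwv => ->.
    by rewrite -[RHS](@qbin_qfact R q (w + v) w) ?addKn //; lia.
  by rewrite -[RHS](@qbin_qfact R q (w + v) v) ?addnK 1?mulrAC //; lia.
rewrite (Ev v Mv) in En.
transitivity ((x * qfact q M) * qbin q (w + v) k); first by ring.
rewrite (mul_qfact_stable xw wM).
rewrite -[LHS]mulr1 -Ey.
transitivity (x * y * (qbin q (w + v) k * qfact q w * qfact q M)).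
  by ring.
by rewrite En -mulrA [y * _]mulrC Ey mulr1.
Qed.

End Truncated.

(** * Theta series *)

Definition theta3 (R : comNzRingType) (q : R) (n : nat) : R :=
  1 + (\sum_(d < n) q ^+ (d.+1 ^ 2)) *+ 2.

(* [psi2 q] is Ramanujan's psi at [q ^ 2], truncated. *)
Definition psi2 (R : comNzRingType) (q : R) (n : nat) : R :=
  \sum_(m < n.+1) q ^+ (m * m.+1).

Lemma sum_symmetric (V : zmodType) (F : nat -> V) (u : nat) :
    (forall d, (d <= u)%N -> F (u - d)%N = F (u + d)%N) ->
  \sum_(i < (2 * u).+1) F i = F u + (\sum_(d < u) F (u + d.+1)%N) *+ 2.
Proof.
move=> Fsym; rewrite -(big_mkord xpredT F).
rewrite (@big_cat_nat _ _ _ u) /=; [|lia..].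
rewrite (@big_ltn _ _ _ u); last by lia.
rewrite -[in X in _ + (_ + X)](add0n u.+1) big_addn addrCA; congr (_ + _).
have -> : ((2 * u).+1 - u.+1 = u)%N by lia.
rewrite mulr2n !big_mkord; congr (_ + _); last first.
  by apply: eq_bigr => d _; congr F; lia.
rewrite (reindex_inj rev_ord_inj) /=; apply: eq_bigr => d _.
by rewrite Fsym.
Qed.

Lemma poly_horner_small (R : comNzRingType) (p : {poly R}) n x :
  (forall i, (n <= i)%N -> p`_i = 0) -> p.[x] = \sum_(i < n) p`_i * x ^+ i.
Proof. by move=> pn; apply/horner_coef_wide/leq_sizeP. Qed.

Lemma qfact_even_odd (R : comNzRingType) (q : R) n :
  qfact (q ^+ 2) n * \prod_(j < n) (1 - q ^+ (2 * j + 1)) = qfact q (2 * n).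
Proof.
elim: n => [|n IHn]; first by rewrite muln0 /qfact !big_ord0 mulr1.
have -> : (2 * n.+1 = (2 * n).+2)%N by lia.
rewrite !qfactS big_ord_recr /= -IHn -exprM addn1.
have -> : (2 * n.+1 = (2 * n).+2)%N by lia.
by ring.
Qed.

Section ThetaSeries.
Variables (R : comNzRingType) (M : nat).

Lemma expr0_le (h : R) m n : h ^+ m = 0 -> (m <= n)%N -> h ^+ n = 0.
Proof. by move=> hm /subnKC <-; rewrite exprD hm mul0r. Qed.

(** Jacobi's triple product. For w = min(i, 2M - i), [qbin_limit] applies because (M-w)^2 + 2(w+1)
    >= 2M; for i > 2M both sides vanish. *)
Lemma coef_jacobi (h : R) (i : nat) : h ^+ (2 * M) = 0 ->
  qfact (h ^+ 2) M * (jacobi_prod h M M)`_i = h ^+ sqdist i M.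
Proof.
move=> hM; rewrite coef_finite_jacobi.
have qM : (h ^+ 2) ^+ M = 0 by rewrite -exprM.
have E := sqdistE i M.
have [le_iM|lt_Mi] := leqP i M.
  have := @qbin_limit R _ M qM (h ^+ sqdist i M) i (2 * M - i) i.
  have -> : (i + (2 * M - i) = M + M)%N by lia.
  apply; [lia | | by left].
  rewrite -exprM -exprD; apply: (expr0_le hM).
  by move/subnK: le_iM E => <-; nia.
have [le_i|lt_i] := leqP i (2 * M); last first.
  rewrite qbin_small ?mulr0; last by lia.
  by rewrite (expr0_le hM) //; move/subnK: lt_Mi E => <-; nia.
have := @qbin_limit R _ M qM (h ^+ sqdist i M) (2 * M - i) i i.
have -> : (2 * M - i + i = M + M)%N by lia.
apply; [lia | | by right].
rewrite -exprM -exprD; apply: (expr0_le hM).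
by move/subnK: lt_Mi le_i E => <-; nia.
Qed.

Lemma qfact_large (q : R) n : q ^+ M = 0 -> (M <= n)%N -> qfact q n = qfact q M.
Proof.
move=> qM Mn; rewrite -[LHS]mul1r (@mul_qfact_stable _ _ _ M) ?mul1r //.
by rewrite exprS qM mulr0.
Qed.

(** The triple product at z = -1: up to sign both products become the product of all 1 - q^(2j+1),
    which [qfact_even_odd] relates to q-factorials. *)
Lemma gauss_theta3 (q : R) : q ^+ M = 0 ->
  theta3 (- q) M * qfact (q ^+ 2) M = qfact q M ^+ 2.
Proof.
move=> qM; have q2M : q ^+ (2 * M) = 0 by rewrite mulnC exprM qM expr0n.
rewrite -(@qfact_large q (2 * M)) //; last by lia.
rewrite -qfact_even_odd.
pose P := jacobi_prod q M M.
have coefP i : (qfact (q ^+ 2) M *: P)`_i = q ^+ sqdist i M.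
  by rewrite coefZ coef_jacobi.
have H : (qfact (q ^+ 2) M *: P).[-1] =
    \sum_(i < (2 * M).+1) q ^+ sqdist i M * (- 1) ^+ i.
  rewrite (@poly_horner_small _ _ (2 * M).+1) => [|i lti].
    by apply: eq_bigr => i _; rewrite coefP.
  rewrite coefP (expr0_le qM) //; move/subnK: lti (sqdistE i M) => <-; nia.
move: H.
rewrite (@sum_symmetric _ (fun i => q ^+ sqdist i M * (- 1) ^+ i)); last first.
  move=> d led; congr (_ ^+ _ * _).
    move/subnK: led (sqdistE (M - d) M) (sqdistE (M + d) M) => <-.
    by rewrite addnK; nia.
  by rewrite -[LHS]signr_odd -[RHS]signr_odd oddD oddB.
have -> : sqdist M M = 0%N by have := sqdistE M M; nia.
rewrite mul1r.
have -> : \sum_(d < M) q ^+ sqdist (M + d.+1) M * (-1) ^+ (M + d.+1) =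
  (-1) ^+ M * \sum_(d < M) (- q) ^+ (d.+1 ^ 2).
  rewrite big_distrr /=; apply: eq_bigr => d _.
  have -> : sqdist (M + d.+1) M = (d.+1 ^ 2)%N.
    by have := sqdistE (M + d.+1) M; rewrite -mulnn; nia.
  have sign_sqr : (-1) ^+ (d.+1 ^ 2) = (-1) ^+ d.+1 :> R.
    by rewrite -[LHS]signr_odd -[RHS]signr_odd oddX.
  by rewrite [(- q) ^+ _]exprNn sign_sqr exprD; ring.
rewrite -mulrnAr -[X in X + _]mulr1 -mulrDr -/(theta3 _ _) => H.
set A := \prod_(j < M) (1 - _).
have Pm1 : P.[-1] = (- 1) ^+ M * A ^+ 2.
  rewrite /P /jacobi_prod hornerM !horner_prod.
  have -> : \prod_(i < M) (1 + q ^+ (2 * i + 1) *: 'X).[-1] = A.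
    by apply: eq_bigr => j _; rewrite !hornerE; ring.
  have -> : \prod_(i < M) ('X + (q ^+ (2 * i + 1))%:P).[-1] = (- 1) ^+ M * A.
    transitivity (\prod_(i < M) ((-1) * (1 - q ^+ (2 * i + 1)))).
      by apply: eq_bigr => j _; rewrite !hornerE; ring.
    by rewrite big_split /= prodr_const card_ord.
  by ring.
apply: (can_inj (signrMK M)) => /=.
by rewrite mulrA -H hornerZ Pm1; ring.
Qed.

(** The triple product at z = h: the factor j = 0 of the second product gives the 2, and the others
    pair up into squares. Working with polynomials allows cancelling ['X^(a.+1)], which would be
    nilpotent after truncation. *)
Lemma poly_psi2 (a : nat) :
  (\prod_(j < a) (1 + 'X^(2 * j.+1))) ^+ 2 *+ 2 =
  \sum_(m < a.+1) 'X^(m * m.+1) *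
     (qbin ('X^2) (a + a.+1) (a - m) + qbin ('X^2) (a + a.+1) (a.+1 + m))
  :> {poly R}.
Proof.
pose P : {poly {poly R}} := jacobi_prod 'X a a.+1.
have coefP i : P`_i = 'X^(sqdist i a.+1) * qbin ('X^2) (a + a.+1) i.
  exact: coef_finite_jacobi.
have PX : P.['X] = 'X^(a.+1) * ((\prod_(j < a) (1 + 'X^(2 * j.+1))) ^+ 2 *+ 2).
  rewrite /P /jacobi_prod hornerM !horner_prod.
  have -> : \prod_(j < a) (1 + 'X^(2 * j + 1) *: 'X).['X] =
      \prod_(j < a) (1 + 'X^(2 * j.+1)) :> {poly R}.
    apply: eq_bigr => j _; rewrite !hornerE -exprSr.
    by congr (_ + _ ^+ _); lia.
  rewrite big_ord_recl /=.
  have -> : \prod_(j < a) ('X + ('X^(2 * bump 0 j + 1))%:P).['X] =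
      'X^a * \prod_(j < a) (1 + 'X^(2 * j.+1)) :> {poly R}.
    have -> : ('X : {poly R}) ^+ a = \prod_(j < a) 'X.
      by rewrite prodr_const card_ord.
    rewrite -big_split; apply: eq_bigr => j _ /=.
    by rewrite !hornerE mulrDr mulr1 -exprS /bump /= add1n addn1.
  by rewrite !hornerE expr1 ['X^(a.+1)]exprS /=; ring.
have {PX} := PX; rewrite (@poly_horner_small _ P (a.+1 + a.+1)); last first.
  by move=> i lei; rewrite coefP qbin_small ?mulr0 //; lia.
rewrite big_split_ord /= (reindex_inj rev_ord_inj) /= -big_split /= => PX.
apply: (@monic_lreg _ 'X^(a.+1)); first exact: monicXn.
rewrite -PX big_distrr; apply: eq_bigr => m _ /=.
have := ltn_ord m => ltm.
rewrite !coefP subSS mulrDr mulrDr mulrAC -exprD !mulrA -exprD.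
rewrite [X in _ + X]mulrAC -!exprD; congr ('X^_ * _ + 'X^_ * _).
  have := sqdistE (a - m) a.+1; nia.
have := sqdistE (a.+1 + m) a.+1; nia.
Qed.

(** Both binomial coefficients of [poly_psi2] become 1/E(q^2). The 2 stays on both sides, as it
    cannot be cancelled modulo 8. *)
Lemma psi2_prod (q : R) : q ^+ M = 0 ->
  psi2 q M *+ 2 =
  (qfact (q ^+ 2) M * (\prod_(j < M) (1 + q ^+ (2 * j.+1))) ^+ 2) *+ 2.
Proof.
move=> qM.
have qbinE n k : (qbin ('X^2) n k).[q] = qbin (q ^+ 2) n k.
  rewrite -[LHS]/(horner_eval q _) rmorph_qbin /=.
  by rewrite /horner_eval hornerXn.
have /(congr1 (fun p => p.[q])) := poly_psi2 M.
rewrite hornerMn horner_exp horner_prod horner_sum => H.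
rewrite -[RHS]mulrnAr.
have -> : \prod_(j < M) (1 + q ^+ (2 * j.+1)) =
    \prod_(i < M) (1 + 'X^(2 * i.+1)).[q].
  by apply: eq_bigr => j _; rewrite !hornerE.
rewrite H big_distrr /psi2 -sumrMnl; apply: eq_bigr => m _ /=.
rewrite hornerM hornerXn hornerD !qbinE.
rewrite mulrDr mulrDr.
have qM2 : (q ^+ 2) ^+ M = 0 by rewrite exprAC qM expr0n.
have q2 : q ^+ (m * m.+1) * (q ^+ 2) ^+ (M - m).+1 = 0.
  rewrite -exprM -exprD; apply: (expr0_le qM); have := ltn_ord m; nia.
have := ltn_ord m => ltm.
have -> : (M + M.+1 = (M - m) + (M.+1 + m))%N by lia.
have wv : (M - m <= M <= M.+1 + m)%N by lia.
by rewrite !(@qbin_limit _ _ _ qM2 _ _ _ _ wv q2) ?mulr2n; [|right|left].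
Qed.

End ThetaSeries.

(** * The generating function modulo 8 *)

(** Used with t = q^2, this says that a truncated series is even in q without mentioning its
    coefficients. *)
Inductive subring_gen (R : comNzRingType) (t : R) : R -> Prop :=
| subring_gen_base : subring_gen t t
| subring_gen1 : subring_gen t 1
| subring_genN x : subring_gen t x -> subring_gen t (- x)
| subring_genD x y :
    subring_gen t x -> subring_gen t y -> subring_gen t (x + y)
| subring_genM x y :
    subring_gen t x -> subring_gen t y -> subring_gen t (x * y).

Section SubringGen.
Variables (R : comNzRingType) (t : R).

Lemma subring_gen0 : subring_gen t 0.
Proof. by rewrite -(subrr 1); do !constructor. Qed.

Lemma subring_gen_sum (I : Type) (r : seq I) (P : pred I) (F : I -> R) :
  (forall i, subring_gen t (F i)) -> subring_gen t (\sum_(i <- r | P i) F i).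
Proof.
by move=> tF; elim/big_ind: _ => //; [apply: subring_gen0|apply: subring_genD].
Qed.

Lemma subring_gen_prod (I : Type) (r : seq I) (P : pred I) (F : I -> R) :
  (forall i, subring_gen t (F i)) -> subring_gen t (\prod_(i <- r | P i) F i).
Proof.
by move=> tF; elim/big_ind: _ => //; [apply: subring_gen1|apply: subring_genM].
Qed.

Lemma subring_genX x n : subring_gen t x -> subring_gen t (x ^+ n).
Proof.
move=> tx; elim: n => [|n IHn]; first by constructor.
by rewrite exprS; apply: subring_genM.
Qed.

Lemma subring_genMn x n : subring_gen t x -> subring_gen t (x *+ n).
Proof.
move=> tx; elim: n => [|n IHn]; first exact: subring_gen0.
by rewrite mulrS; apply: subring_genD.
Qed.

Lemma subring_gen_qfact_inv x M n : subring_gen t x ->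
  subring_gen t (qfact_inv x M n).
Proof.
move=> tx; apply: subring_gen_prod => j; apply: subring_gen_sum => i.
by do 2!apply: subring_genX.
Qed.

Lemma subring_gen_coefX (p : {poly R}) n :
  (forall i, subring_gen t p`_i) -> forall i, subring_gen t (p ^+ n)`_i.
Proof.
move=> tp; elim: n => [|n IHn] i.
  by rewrite expr0 coef1; case: (i == 0%N); [constructor|apply: subring_gen0].
by rewrite exprS coefM; apply: subring_gen_sum => j; apply: subring_genM.
Qed.

End SubringGen.

Section CongruenceModTwo.
Variable R : comNzRingType.

Lemma sqr_sum_mod2 (I : Type) (r : seq I) (F : I -> R) :
  exists t, (\sum_(i <- r) F i) ^+ 2 = \sum_(i <- r) F i ^+ 2 + 2%:R * t.
Proof.
elim: r => [|i r [t IHr]]; first by exists 0; rewrite !big_nil; ring.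
exists (t + F i * \sum_(i <- r) F i).
by rewrite !big_cons sqrrD IHr; ring.
Qed.

Lemma prod_mod2 (I : Type) (r : seq I) (F G H : I -> R) :
    (forall i, F i = G i + 2%:R * H i) ->
  exists t, \prod_(i <- r) F i = \prod_(i <- r) G i + 2%:R * t.
Proof.
move=> FG; elim: r => [|i r [t IHr]]; first by exists 0; rewrite !big_nil; ring.
exists (F i * t + H i * \prod_(i <- r) G i).
by rewrite !big_cons IHr FG; ring.
Qed.

Hypothesis R8 : 8%:R = 0 :> R.

Lemma eq_mod8 (x y z : R) : x = y + 8%:R * z -> x = y.
Proof. by rewrite R8 mul0r addr0. Qed.

(** In the expansion of (y + 2t)^4 - y^4 all coefficients are divisible by 8. This lifts congruences
    modulo 2 to congruences modulo 8. *)
Lemma expr4_mod2 (x y t : R) : x = y + 2%:R * t -> x ^+ 4 = y ^+ 4.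
Proof.
move=> ->; apply: (@eq_mod8 _ _ (y ^+ 3 * t + 3%:R * y ^+ 2 * t ^+ 2 +
  4%:R * y * t ^+ 3 + 2%:R * t ^+ 4)); ring.
Qed.

End CongruenceModTwo.

Section ThetaPolynomials.
Variables (R : comNzRingType) (h : R) (M : nat).

(** The series theta(z^m, h^k), truncated and multiplied by z^(mM). *)
Definition theta_poly (k m : nat) : {poly R} :=
  \sum_(i < (2 * M).+1) h ^+ (k * sqdist i M) *: 'X^(m * i).

Lemma theta_poly_sqr k m :
  exists t, theta_poly k m ^+ 2 = theta_poly (2 * k) (2 * m) + 2%:R * t.
Proof.
have [t ->] := sqr_sum_mod2 (index_enum 'I_(2 * M).+1)
  (fun i => h ^+ (k * sqdist i M) *: 'X^(m * i)).
exists t; congr (_ + _); apply: eq_bigr => i _.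
by rewrite exprZn -!exprM; congr (_ ^+ _ *: 'X^_); lia.
Qed.

Lemma theta_poly_comp k m : theta_poly k m = theta_poly k 1 \Po 'X^m.
Proof.
rewrite /theta_poly linear_sum /=; apply: eq_bigr => i _.
by rewrite comp_polyZ comp_Xn_poly mul1n -exprM.
Qed.

Lemma coef_theta_poly k i : 
  (theta_poly k 1)`_i = if (i < (2 * M).+1)%N then h ^+ (k * sqdist i M) else 0.
Proof.
have -> : theta_poly k 1 = \poly_(j < (2 * M).+1) h ^+ (k * sqdist j M).
  by rewrite poly_def; apply: eq_bigr => j _; rewrite mul1n.
by rewrite coef_poly.
Qed.

End ThetaPolynomials.

Lemma coef_mul_comp_Xn (R : comNzRingType) (p g : {poly R}) d n N :
  (size g <= N)%N ->
  (p * (g \Po 'X^d))`_n =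
  \sum_(k < N) g`_k * (if (n < d * k)%N then 0 else p`_(n - d * k)).
Proof.
move=> gN; have -> : g \Po 'X^d = \sum_(k < N) g`_k *: 'X^(d * k).
  rewrite /comp_poly (@horner_coef_wide _ N) ?size_map_polyC //.
  by apply: eq_bigr => k _; rewrite coef_map /= mul_polyC exprM.
rewrite mulr_sumr coef_sum; apply: eq_bigr => k _.
by rewrite -scalerAr coefZ coefMXn.
Qed.

Lemma sum_parity (V : nmodType) (F : nat -> V) n :
  \sum_(d < 2 * n) F d = \sum_(j < n) F (2 * j).+1 + \sum_(j < n) F (2 * j)%N.
Proof.
elim: n => [|n IHn]; first by rewrite muln0 !big_ord0 addr0.
have -> : (2 * n.+1 = (2 * n).+2)%N by lia.
by rewrite !big_ord_recr /= IHn addrACA -addrA [F (2 * n)%N + _]addrC.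
Qed.

Section ModEight.
Variables (R : comNzRingType) (h : R) (M : nat).
Hypothesis M_gt0 : (0 < M)%N.
Hypothesis hM : h ^+ (2 * M) = 0.
Hypothesis R8 : 8%:R = 0 :> R.

Let q := h ^+ 2.

Let qM : q ^+ M = 0. Proof. by rewrite -exprM. Qed.

Let poly8 : 8%:R = 0 :> {poly R}.
Proof. by rewrite -(rmorph_nat (@polyC R)) R8. Qed.

(** Two squarings modulo 2 lead from theta(z, h) to theta(z^4, h^4); each becomes exact modulo 8
    after a fourth power. *)
Lemma theta_poly18 :
  theta_poly h M 1 1 ^+ 18 =
  theta_poly h M 1 1 ^+ 2 * (theta_poly h M 4 1 ^+ 4 \Po 'X^4).
Proof.
have [t1 E1] := theta_poly_sqr h M 1 1.
have [t2 E2] := theta_poly_sqr h M 2 2.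
rewrite rmorphXn /= -theta_poly_comp.
rewrite -(expr4_mod2 poly8 E2) -exprM -[(2 * 4)%N]/(4 * 2)%N exprM.
by rewrite -(expr4_mod2 poly8 E1) -!exprM -exprD.
Qed.

(** The squared distances of j and 2u - j to M add up to 2(u-M)^2 + 2(j-u)^2, which separates the
    monomial from phi(q). *)
Lemma coef_theta_poly_sqr u :
  (theta_poly h M 1 1 ^+ 2)`_(2 * u) = h ^+ (2 * sqdist u M) * theta3 q M.
Proof.
have coefT i : (theta_poly h M 1 1)`_i = h ^+ sqdist i M.
  rewrite coef_theta_poly mul1n; case: ltnP => // lti.
  rewrite (expr0_le hM) //; move/subnK: lti (sqdistE i M) => <-; nia.
rewrite expr2 coefM.
have -> : \sum_(j < (2 * u).+1)
    (theta_poly h M 1 1)`_j * (theta_poly h M 1 1)`_(2 * u - j) =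
    h ^+ (2 * sqdist u M) * \sum_(j < (2 * u).+1) q ^+ (sqdist j u).
  rewrite big_distrr; apply: eq_bigr => j _ /=.
  rewrite !coefT -exprM -!exprD; congr (_ ^+ _).
  have := sqdistE j M; have := sqdistE (2 * u - j) M; have := sqdistE u M.
  have := sqdistE j u; move/subnK: (ltn_ord j); nia.
rewrite (@sum_symmetric _ (fun j => q ^+ sqdist j u)); last first.
  by move=> d led; congr (_ ^+ _); have := sqdistE (u - d) u;
    have := sqdistE (u + d) u; move/subnK: led => <-; rewrite addnK; nia.
have -> : sqdist u u = 0%N by have := sqdistE u u; nia.
have sqD d : sqdist (u + d) u = (d ^ 2)%N.
  by have := sqdistE (u + d) u; rewrite -mulnn; nia.
rewrite /theta3 expr0 mulrDr [RHS]mulrDr; congr (_ + _).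
rewrite !mulrnAr; congr (_ *+ 2).
under eq_bigr do rewrite sqD.
have vanish d : (M <= d)%N -> q ^+ (d.+1 ^ 2) = 0.
  by move=> led; rewrite (expr0_le qM) // -mulnn; nia.
have vanish' d : (u <= d < M)%N -> h ^+ (2 * sqdist u M) * q ^+ (d.+1 ^ 2) = 0.
  move=> /andP[led ltd]; rewrite -exprM -exprD (expr0_le hM) //.
  have := sqdistE u M; rewrite -mulnn; have /subnK <- : (u <= M)%N by lia.
  nia.
rewrite !big_distrr /=.
pose F d := h ^+ (2 * sqdist u M) * q ^+ (d.+1 ^ 2).
(* The sums over [d < u] and [d < M] both reduce to [d < minn u M], as later terms vanish by
   truncation. *)
have F0 d : (minn u M <= d)%N -> F d = 0.
  rewrite geq_min => led; rewrite /F.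
  by have [leMd|ltdM] := leqP M d; [rewrite vanish ?mulr0|apply: vanish'; lia].
have trunc n : (minn u M <= n)%N -> \sum_(d < n) F d = \sum_(d < minn u M) F d.
  move=> len; rewrite -!(big_mkord xpredT F).
  rewrite (@big_cat_nat _ _ _ (minn u M)) //= -[RHS]addr0; congr (_ + _).
  by rewrite big_nat big1 // => d /andP[+ _]; apply: F0.
by rewrite (trunc u) ?(trunc M) // ?geq_minl ?geq_minr.
Qed.

(** Only the even indices 18M - 4k of theta^2 occur, so phi(q) factors out. The equation 4G = 4
    expresses G = 1 modulo 2. *)
Lemma coef_theta_poly18 : exists2 G,
  subring_gen (q ^+ 2) G /\ 4%:R * G = 4%:R &
  (theta_poly h M 1 1 ^+ 18)`_(18 * M) = theta3 q M * G.
Proof.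
set g := theta_poly h M 4 1 ^+ 4.
(* The term 8M + 1 keeps every index 4i with i <= 2M below [N]. The exponent in the witness is 2(9M
   - 2k - M)^2 = 8(k - 4M)^2. *)
pose N := (size g + (8 * M).+1)%N.
exists (\sum_(k < N) g`_k * h ^+ (8 * sqdist k (4 * M))); last first.
  rewrite theta_poly18 -/g.
  rewrite (@coef_mul_comp_Xn _ _ _ _ _ N) ?leq_addr // big_distrr.
  apply: eq_bigr => k _ /=.
  have -> : (18 * M - 4 * k = 2 * (9 * M - 2 * k))%N by lia.
  rewrite coef_theta_poly_sqr mulrCA; congr (_ * _); rewrite mulrC.
  have E1 := sqdistE k (4 * M); have E2 := sqdistE (9 * M - 2 * k) M.
  (* If 4k > 18M the coefficient is 0 by default, and the power vanishes since 8(k - 4M)^2 >= 2M. *)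
  have [lt|le] := ltnP (18 * M) (4 * k).
    rewrite (expr0_le hM) ?mulr0 //; nia.
  congr (_ * _ ^+ _); nia.
split.
  apply: subring_gen_sum => k; apply: subring_genM.
    apply: subring_gen_coefX => i; rewrite coef_theta_poly.
    case: ifP => _; last exact: subring_gen0.
    rewrite exprM -[4%N]/(2 * 2)%N exprM.
    by apply/subring_genX/subring_gen_base.
  rewrite -[8%N]/(2 * 2 * 2)%N -!mulnA 2!exprM.
  exact/subring_genX/subring_gen_base.
have [t1 E1] := theta_poly_sqr h M 4 1.
have [t2 E2] := theta_poly_sqr h M 8 2.
have g4 : 4%:R * g = 4%:R * theta_poly h M 16 4.
  have -> : g = (theta_poly h M 4 1 ^+ 2) ^+ 2 by rewrite -exprM.
  rewrite E1 sqrrD E2.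
  apply: (@eq_mod8 _ poly8 _ _
    (t2 + 2%:R * theta_poly h M 8 2 * t1 + 2%:R * t1 ^+ 2)).
  by ring.
have {}g4 k : 4%:R * g`_k = 4%:R *
    \sum_(i < (2 * M).+1) h ^+ (16 * sqdist i M) * (k == (4 * i)%N)%:R.
  have := congr1 (fun p : {poly R} => p`_k) g4.
  rewrite !mulr_natl !coefMn => ->; rewrite coef_sum; congr (_ *+ 4).
  by apply: eq_bigr => i _; rewrite coefZ coefXn.
(* 144 = 16 + 8 * 16, since [sqdist (4 * i) (4 * M)] is 16 times [sqdist i M]. *)
have -> : 4%:R * (\sum_(k < N) g`_k * h ^+ (8 * sqdist k (4 * M))) =
    4%:R * \sum_(i < (2 * M).+1) (h ^+ 144) ^+ sqdist i M.
  rewrite big_distrr /=; under eq_bigr do rewrite mulrA g4 -mulrA mulr_suml.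
  rewrite -big_distrr /= exchange_big /=; congr (_ * _); apply: eq_bigr => i _.
  have lti : (4 * i < N)%N by have := ltn_ord i; rewrite /N; lia.
  rewrite (bigD1 (Ordinal lti)) //= eqxx mulr1 big1 => [|j neqj].
    rewrite addr0 -!exprD -exprM; congr (_ ^+ _).
    have := sqdistE i M; have := sqdistE (4 * i) (4 * M); nia.
  by rewrite (_ : (val j == (4 * i)%N) = false) ?mulr0 ?mul0r //; apply/negbTE.
(* The terms i and 2M - i agree, so 4 times all but the central term 1 cancels modulo 8. *)
rewrite (@sum_symmetric _ (fun i => (h ^+ 144) ^+ sqdist i M)); last first.
  by move=> d led; congr (_ ^+ _); have := sqdistE (M - d) M;
    have := sqdistE (M + d) M; move/subnK: led => <-; rewrite addnK; nia.
have -> : sqdist M M = 0%N by have := sqdistE M M; nia.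
rewrite expr0 mulrDr mulr1 -[RHS]addr0; congr (_ + _).
rewrite mulrnAr -mulrnAl; suff -> : 4%:R *+ 2 = 0 :> R by rewrite mul0r.
by rewrite -mulrnA.
Qed.


(** Factorwise (1-x)^2 = 1 - x^2 modulo 2, so E(q)^2 = E(q^2) modulo 2; eighth powers then agree
    modulo 8. *)
Lemma qfact_exp16 : qfact q M ^+ 16 = qfact (q ^+ 2) M ^+ 8.
Proof.
have E2 (j : 'I_M) : (1 - q ^+ j.+1) ^+ 2 =
    (1 - (q ^+ 2) ^+ j.+1) + 2%:R * (q ^+ j.+1 * (q ^+ j.+1 - 1)).
  by rewrite exprAC; ring.
have [t E] := prod_mod2 (index_enum 'I_M) E2.
rewrite prodrXl in E.
have := expr4_mod2 R8 E => /(congr1 (fun x => x ^+ 2)).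
by rewrite -!exprM.
Qed.

(** The product in [psi2_prod] is E(q^2) modulo 2, and the factor 4 absorbs the error. *)
Lemma psi2_qfact : 4%:R * psi2 q M = 4%:R * qfact (q ^+ 2) M ^+ 3.
Proof.
have E2 (j : 'I_M) : 1 + q ^+ (2 * j.+1) =
    (1 - (q ^+ 2) ^+ j.+1) + 2%:R * q ^+ (2 * j.+1).
  by rewrite exprM; ring.
have [t E] := prod_mod2 (index_enum 'I_M) E2.
have := psi2_prod qM.
rewrite E -/(qfact _ _) => H.
have -> : 4%:R * psi2 q M = 2%:R * (psi2 q M *+ 2) by ring.
rewrite H; apply: (@eq_mod8 _ R8 _ _ ((qfact (q ^+ 2) M *
   (qfact (q ^+ 2) M * t * 2%:R + 2%:R * t ^+ 2)))); ring.
Qed.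

(** The parts of phi with odd and with even d > 0; [So] is the series S. *)
Let So := \sum_(j < M) q ^+ ((2 * j).+1 ^ 2).
Let Se := \sum_(j < M) q ^+ ((2 * j).+2 ^ 2).

(** As d^2 has the parity of d, the sign e reaches only the odd part; e = 1 and e = -1 give phi(q)
    and phi(-q). *)
Lemma theta3_split (e : R) : e ^+ 2 = 1 ->
  theta3 (e * q) M = 1 + 2%:R * (Se + e * So).
Proof.
move=> e2; rewrite /theta3 -mulr_natl; congr (_ + _ * _).
transitivity (\sum_(d < 2 * M) (e * q) ^+ (d.+1 ^ 2)).
  rewrite -!(big_mkord xpredT (fun d => (e * q) ^+ (d.+1 ^ 2))).
  rewrite [RHS](@big_cat_nat _ _ _ M) //=; last by lia.
  rewrite -[LHS]addr0; congr (_ + _).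
  rewrite big_nat big1 // => d /andP[leMd _].
  by rewrite exprMn (expr0_le qM) ?mulr0 // -mulnn; nia.
rewrite (sum_parity (fun d => (e * q) ^+ (d.+1 ^ 2))) big_distrr /=.
congr (_ + _); apply: eq_bigr => j _; rewrite exprMn.
  have -> : e ^+ ((2 * j).+2 ^ 2) = 1; last by rewrite mul1r.
  have -> : ((2 * j).+2 ^ 2 = 2 * (2 * j.+1 ^ 2))%N by rewrite -!mulnn; lia.
  by rewrite exprM e2 expr1n.
have -> : e ^+ ((2 * j).+1 ^ 2) = e; last by [].
have -> : ((2 * j).+1 ^ 2 = (2 * (2 * (j * j.+1))).+1)%N.
  by rewrite -!mulnn; lia.
by rewrite exprS exprM e2 expr1n mulr1.
Qed.

(** As (2j+1)^2 = 1 + 4j(j+1), [So] is q times [psi2] at q^4, which is the fourth power of [psi2] at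
    q modulo 2. *)
Lemma odd_part_psi2 : 4%:R * So = 4%:R * q * psi2 q M ^+ 4.
Proof.
have [t1 E1] := sqr_sum_mod2 (index_enum 'I_M.+1) (fun m => q ^+ (m * m.+1)).
have [t2 E2] := sqr_sum_mod2 (index_enum 'I_M.+1)
  (fun m => (q ^+ (m * m.+1)) ^+ 2).
set B := \sum_(m < M.+1) (q ^+ (m * m.+1)) ^+ 2 in E1 E2.
have -> : psi2 q M ^+ 4 = (psi2 q M ^+ 2) ^+ 2 by rewrite -exprM.
rewrite /psi2 E1 sqrrD E2 big_ord_recr /=.
have -> : ((q ^+ (M * M.+1)) ^+ 2) ^+ 2 = 0.
  by rewrite [q ^+ _]exprM qM !expr0n.
have -> : So = q * \sum_(i < M) ((q ^+ (i * i.+1)) ^+ 2) ^+ 2.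
  rewrite big_distrr; apply: eq_bigr => i _ /=.
  have expr4n (x : R) n : ((x ^+ n) ^+ 2) ^+ 2 = x ^+ (4 * n).
    by rewrite -!exprM; congr (_ ^+ _); lia.
  by rewrite expr4n -exprS; congr (_ ^+ _); rewrite -mulnn; lia.
apply: (@eq_mod8 _ R8 _ _ (- (q * (t2 + 2%:R * B * t1 + 2%:R * t1 ^+ 2)))).
by ring.
Qed.

Lemma qfact_jacobi_coef18 :
  qfact q M ^+ 18 * (jacobi_prod h M M ^+ 18)`_(18 * M) =
  (theta_poly h M 1 1 ^+ 18)`_(18 * M).
Proof.
rewrite -coefZ -exprZn; congr (polyseq (_ ^+ _))`_ _; apply/polyP => i.
rewrite coefZ coef_jacobi // coef_theta_poly mul1n; case: ltnP => // lti.
rewrite (expr0_le hM) //; move/subnK: lti (sqdistE i M) => <-; nia.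
Qed.

Lemma jacobi_coef18 : exists2 w, subring_gen (q ^+ 2) w &
  (jacobi_prod h M M ^+ 18)`_(18 * M) = w + 4%:R * q * psi2 q M.
Proof.
have := qfact_jacobi_coef18; set C := (jacobi_prod h M M ^+ 18)`_(18 * M).
have [G [tG G4] ->] := coef_theta_poly18.
set e := qfact q M; set f := qfact (q ^+ 2) M; set y := qfact_inv (q ^+ 2) M M.
have fy : f * y = 1 by apply: qfactK; rewrite exprAC qM expr0n.
have ty : subring_gen (q ^+ 2) y.
  exact/subring_gen_qfact_inv/subring_gen_base.
have := theta3_split (expr1n R 2); rewrite !mul1r => phiE.
have := theta3_split (etrans (sqrrN 1) (expr1n R 2)); rewrite !mulN1r => phiNE.
have e2 := gauss_theta3 qM; rewrite -/e -/f in e2.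
move=> eC.
have {eC} C1 : theta3 (- q) M * f ^+ 9 * C = theta3 q M * G.
  rewrite -eC (exprD _ 2 16) qfact_exp16 -/e -/f -e2; ring.
pose So2 := So ^+ 2.
have tSe : subring_gen (q ^+ 2) Se.
  apply: subring_gen_sum => j.
  have -> : ((2 * j).+2 ^ 2 = 2 * (2 * j.+1 ^ 2))%N by rewrite -!mulnn; lia.
  by rewrite exprM; apply/subring_genX/subring_gen_base.
have tSo2 : subring_gen (q ^+ 2) So2.
  rewrite /So2 [So ^+ 2]expr2 big_distrlr /=; apply: subring_gen_sum => i.
  apply: subring_gen_sum => j; rewrite -exprD.
  have -> : ((2 * i).+1 ^ 2 + (2 * j).+1 ^ 2 =
             2 * (2 * (i * i.+1) + 2 * (j * j.+1) + 1))%N.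
    by rewrite -!mulnn; lia.
  by rewrite exprM; apply/subring_genX/subring_gen_base.
(* Chosen so that phi(q) phi(-q) = 1 + 4v. *)
pose v := Se + Se ^+ 2 - So2.
have tv : subring_gen (q ^+ 2) v.
  by apply: subring_genD; [apply: subring_genD => //; apply: subring_genX
                          |apply: subring_genN].
(* Chosen so that phi(q)^2 = W + 4 So modulo 8; the cross term is 8 Se So. *)
pose W := 1 + 4%:R * (Se + Se ^+ 2 + So2).
have tW : subring_gen (q ^+ 2) W.
  apply: subring_genD; first by constructor.
  rewrite mulr_natl; apply/subring_genMn/subring_genD => //.
  by apply: subring_genD => //; apply: subring_genX.
have C2 : C = y ^+ 9 * (1 - 4%:R * v) * (W + 4%:R * So) * G.
  have C3 : (1 + 4%:R * v) * f ^+ 9 * C = (W + 4%:R * So) * G.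
    transitivity (theta3 q M * (theta3 (- q) M * f ^+ 9 * C)).
      rewrite phiE phiNE /v /So2; ring.
    rewrite C1 phiE /W /So2; apply: (@eq_mod8 _ R8 _ _ (Se * So * G)); ring.
  (* Modulo 8 the inverse of 1 + 4v is 1 - 4v, as 16 v^2 vanishes. *)
  rewrite -[_ * G]mulrA -C3.
  transitivity ((f * y) ^+ 9 * C); first by rewrite fy expr1n mul1r.
  apply: (@eq_mod8 _ R8 _ _ (2%:R * v ^+ 2 * (f * y) ^+ 9 * C)); ring.
have tv4 : subring_gen (q ^+ 2) (1 - 4%:R * v).
  apply: subring_genD; first by constructor.
  by rewrite mulr_natl; apply/subring_genN/subring_genMn.
exists (y ^+ 9 * (1 - 4%:R * v) * W * G).
  by apply/subring_genM/tG/subring_genM/tW/subring_genM/tv4/subring_genX/ty.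
(* Follows from 4p = 4f^3 by factoring p^3 - f^9; the f^9 produced here cancels y^9. *)
have psi4 : 4%:R * psi2 q M ^+ 4 = 4%:R * psi2 q M * f ^+ 9.
  have := psi2_qfact; rewrite -/f; set p := psi2 q M => pf.
  have -> : 4%:R * p ^+ 4 = (4%:R * p - 4%:R * f ^+ 3) * p *
      (p ^+ 2 + p * f ^+ 3 + f ^+ 6) + 4%:R * p * f ^+ 9 by ring.
  by rewrite {1}pf subrr !mul0r add0r.
rewrite C2 mulrDr mulrDl; congr (_ + _).
transitivity ((4%:R * G) * So * y ^+ 9 * (1 - 4%:R * v)); first by ring.
rewrite G4 odd_part_psi2.
transitivity (q * (4%:R * psi2 q M ^+ 4) * y ^+ 9 * (1 - 4%:R * v)).
  by ring.
rewrite psi4.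
transitivity (4%:R * q * psi2 q M * (f * y) ^+ 9 * (1 - 4%:R * v)).
  by ring.
rewrite fy expr1n; apply: (@eq_mod8 _ R8 _ _ (- (2%:R * q * psi2 q M * v))).
by ring.
Qed.

End ModEight.

(** * Counting *)

Section Counting.
Variables (k M : nat).
Let T : finType := ('I_M * 'I_k)%type.

Definition odd_weight (A : {set T}) : nat := (\sum_(x in A) (2 * x.1 + 1))%N.

Definition forget_bound (A : {set T}) : {fset nat * 'I_k} :=
  [fset (nat_of_ord x.1, x.2) | x in A]%fset.

Let forget_entry_inj : injective (fun x : T => (nat_of_ord x.1, x.2)).
Proof. by move=> [i c] [j d] [/ord_inj -> ->]. Qed.

Lemma forget_bound_inj : injective forget_bound.
Proof.
move=> A B AB; apply/setP => x.
have mem (C : {set T}) : (x \in C) = ((nat_of_ord x.1, x.2) \in forget_bound C).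
  by rewrite (mem_imfset _ _ forget_entry_inj).
by rewrite !mem AB.
Qed.

Lemma card_forget_bound A : #|` forget_bound A|%fset = #|A|.
Proof. by rewrite card_imfset //= -cardE. Qed.

Lemma row_sum_forget_bound A :
  odd_weight A = (2 * row_sum (forget_bound A) + #|A|)%N.
Proof.
rewrite /row_sum big_imfset /=; last by move=> x y _ _ /forget_entry_inj.
by rewrite /odd_weight big_split /= sum1_card -big_distrr /= big_enum.
Qed.

(** In two rows of r entries the weights 2a + 1 add up to 2r plus twice the sum of the entries, that
    is 2n. Entries are at most n, so they fit below M. *)
Lemma cphi_card n : (n < M)%N ->
  cphi k n = #|[set p : {set T} * {set T} |
    (#|p.1| == #|p.2|) && (odd_weight p.1 + odd_weight p.2 == 2 * n)%N]|.
Proof.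
move=> ltnM; rewrite /cphi; set S := [set p | _].
pose f (p : {set T} * {set T}) := (forget_bound p.1, forget_bound p.2).
have f_inj : injective f.
  by move=> [A B] [C D] [/forget_bound_inj -> /forget_bound_inj ->].
have fS p : is_gfp n (f p) = (p \in S).
  rewrite inE /is_gfp !card_forget_bound !row_sum_forget_bound.
  by case: eqP => //= ->; lia.
suff -> : gfps k n = [fset f p | p in S]%fset by rewrite card_imfset //= -cardE.
apply/fsetP => p; apply/idP/idP => [p_gfp|/imfsetP[p' /= p'S ->]]; last first.
  by rewrite mem_gfps fS.
pose g (A : {fset nat * 'I_k}) : {set T} :=
  [set x | (nat_of_ord x.1, x.2) \in A].
have gK A : (A `<=` entries k n)%fset -> forget_bound (g A) = A.
  move=> /fsubsetP sA; apply/fsetP => x; apply/imfsetP/idP => /=.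
    by case=> y; rewrite inE => ? ->.
  move=> xA; have := sA x xA; rewrite in_fsetM !in_fset => /andP[+ _].
  rewrite mem_iota /= => ltx.
  have ltxM : (x.1 < M)%N by apply: (leq_trans ltx).
  by exists (Ordinal ltxM, x.2); rewrite ?inE /= -?surjective_pairing.
have : p = f (g p.1, g p.2).
  move: p_gfp; rewrite !inE /= !fpowersetE => /andP[/andP[s1 s2] _].
  by rewrite /f /= !gK // -surjective_pairing.
move=> pE; rewrite pE; apply/imfsetP; exists (g p.1, g p.2) => //=.
by rewrite -fS -pE -mem_gfps.
Qed.

(** Here [p.2] collects the factors of the second product contributing their constant; the others
    contribute ['X], whence the complement in the degree. *)
Lemma jacobi_prodX (R : comNzRingType) (h : R) :
  jacobi_prod h M M ^+ k =
  \sum_(p : {set T} * {set T})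
    h ^+ (odd_weight p.1 + odd_weight p.2) *: 'X^(#|p.1| + #|~: p.2|).
Proof.
have powE (F : 'I_M -> {poly R}) :
    (\prod_(j < M) F j) ^+ k = \prod_(x : T) F x.1.
  rewrite -prodrXl -(pair_bigA _ (fun j (c : 'I_k) => F j)) /=.
  by apply: eq_bigr => j _; rewrite prodr_const card_ord.
rewrite /jacobi_prod exprMn !powE.
have -> : \prod_(x : T) (1 + h ^+ (2 * x.1 + 1) *: 'X) =
    \sum_(A : {set T}) h ^+ odd_weight A *: 'X^#|A|.
  under eq_bigr do rewrite addrC.
  rewrite bigA_distr; apply: eq_bigr => A _; rewrite -big_mkcond /=.
  under eq_bigr do rewrite -mul_polyC.
  by rewrite big_split /= prodr_const -rmorph_prod /= mul_polyC -expr_sum.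
have -> : \prod_(x : T) ('X + (h ^+ (2 * x.1 + 1))%:P) =
    \sum_(B : {set T}) h ^+ odd_weight B *: 'X^#|~: B|.
  under eq_bigr do rewrite addrC.
  rewrite bigA_distr; apply: eq_bigr => B _.
  rewrite (bigID (mem B)) /=.
  rewrite (eq_bigr (fun x : T => (h ^+ (2 * x.1 + 1))%:P)); last first.
    by move=> x ->.
  rewrite -rmorph_prod /= -expr_sum mul_polyC; congr (_ *: _).
  rewrite (eq_bigr (fun=> 'X)); last by move=> x /negbTE ->.
  rewrite prodr_const; congr ('X^_); apply: eq_card => x; by rewrite !inE.
rewrite big_distrlr pair_bigA /=; apply: eq_bigr => p _.
by rewrite -scalerAl -scalerAr scalerA -!exprD.
Qed.

End Counting.

(** * Reading off coefficients, and the conclusion modulo 8 *)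

Lemma coef_jacobi_cphi (R : comNzRingType) k n :
  ((jacobi_prod ('X : {poly R}) n.+1 n.+1 ^+ k)`_(k * n.+1))`_(2 * n) =
  (cphi k n)%:R.
Proof.
rewrite (cphi_card _ (leqnn _)) jacobi_prodX coef_sum coef_sum.
rewrite -sum1_card natr_sum.
rewrite [RHS]big_mkcond /=; apply: eq_bigr => p _.
rewrite coefZ coefXn mulr_natr coefMn coefXn inE.
(* The complement of [p.2] has k(n+1) - #|p.2| elements, so the central degree selects rows of equal
   length. *)
have -> : (k * n.+1 == #|p.1| + #|~: p.2|)%N = (#|p.1| == #|p.2|).
  have := cardsC p.2; rewrite card_prod !card_ord; lia.
by rewrite [(2 * n)%N == _]eq_sym; do 2!case: (_ == _).
Qed.

Lemma in_qpolyXn_coef (R : comNzRingType) N (p p' : {poly R}) i : (i < N)%N ->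
  in_qpoly 'X^N p = in_qpoly 'X^N p' -> p`_i = p'`_i.
Proof.
case: N => // N ltiN /(congr1 (fun x : {poly %/ 'X^(N.+1)} => x : {poly R})).
rewrite /= mk_monic_Xn /= => E.
have divE := Pdiv.RingMonic.rdivp_eq (monicXn R N.+1).
by rewrite [p]divE [p']divE !coefD !coefMXn ltiN E.
Qed.

(** Series even in q = h^2 lift to polynomials in ['X^4], where coefficients can be compared. *)
Lemma subring_gen_in_qpolyXn (R : comNzRingType) N
    (w : {poly %/ ('X^N : {poly R})}) :
  subring_gen (in_qpoly 'X^N 'X ^+ 4) w ->
  exists p : {poly R}, w = in_qpoly 'X^N (p \Po 'X^4).
Proof.
elim=> [| |x _ [p ->]|x y _ [p ->] _ [p' ->]|x y _ [p ->] _ [p' ->]].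
- by exists 'X; rewrite comp_polyX rmorphXn.
- by exists 1; rewrite rmorph1 rmorph1.
- by exists (- p); rewrite 2!rmorphN.
- by exists (p + p'); rewrite !rmorphD.
- by exists (p * p'); rewrite !rmorphM.
Qed.

Lemma rmorph_jacobi_prod (R S : comNzRingType) (f : {rmorphism R -> S}) h a b :
  map_poly f (jacobi_prod h a b) = jacobi_prod (f h) a b.
Proof.
rewrite /jacobi_prod rmorphM !rmorph_prod /=.
congr (_ * _); apply: eq_bigr => j _.
  by rewrite rmorphD rmorph1 /= map_polyZ map_polyX rmorphXn.
by rewrite rmorphD /= map_polyX map_polyC /= rmorphXn.
Qed.

Lemma rmorph_psi2 (R S : comNzRingType) (f : {rmorphism R -> S}) q n :
  f (psi2 q n) = psi2 (f q) n.
Proof. by rewrite rmorph_sum; apply: eq_bigr => i _; rewrite rmorphXn. Qed.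

Lemma cphi18_Z8 (n : nat) : (cphi 18 (6 * n + 5))%:R = 0 :> 'Z_8.
Proof.
pose R : comNzRingType := 'Z_8.
set m := (6 * n + 5)%N; pose N := (2 * m.+1)%N.
pose K : comNzRingType := {poly %/ ('X^N : {poly R})}.
pose pi : {rmorphism {poly R} -> K} := in_qpoly ('X^N : {poly R}).
pose h : K := pi 'X.
have R8 : 8%:R = 0 :> R by apply/val_inj.
have hN : h ^+ (2 * m.+1) = 0.
  rewrite -rmorphXn /=; apply/val_inj => /=.
  rewrite mk_monic_Xn -[(2 * m.+1)%N]/N /N prednK //.
  by rewrite Pdiv.RingMonic.rmodpp ?monicXn.
have K8 : 8%:R = 0 :> K.
  by rewrite -(rmorph_nat pi) -(rmorph_nat (@polyC R)) R8 !rmorph0.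
have [w tw E] := @jacobi_coef18 K h m.+1 isT hN K8.
have [p wE] : exists p : {poly R}, w = pi (p \Po 'X^4).
  by apply: subring_gen_in_qpolyXn; rewrite -[4%N]/(2 * 2)%N exprM.
pose C := (jacobi_prod ('X : {poly R}) m.+1 m.+1 ^+ 18)`_(18 * m.+1).
have {E wE tw} CE : pi C = pi (p \Po 'X^4 + 4%:R * 'X^2 * psi2 ('X^2) m.+1).
  have -> : pi C = (jacobi_prod h m.+1 m.+1 ^+ 18)`_(18 * m.+1).
    rewrite /C -coef_map; congr (polyseq _)`_ _; rewrite rmorphXn.
    by congr (_ ^+ _); apply: rmorph_jacobi_prod.
  rewrite E wE [RHS]rmorphD; congr (_ + _).
  rewrite [RHS]rmorphM [pi (4%:R * _)]rmorphM.
  by rewrite rmorph_nat rmorph_psi2 [pi 'X^2]rmorphXn.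
have {CE} := in_qpolyXn_coef (_ : (2 * m < N)%N) CE.
rewrite coef_jacobi_cphi => CE.
rewrite CE; last by rewrite /N; lia.
rewrite coefD coef_comp_poly_Xn //.
(* 2m = 12n + 10 is not a multiple of 4, so the even part contributes nothing. *)
have -> : (4 %| 2 * m)%N = false by rewrite /m; lia.
rewrite add0r -mulrA mulr_natl coefMn big_distrr coef_sum.
rewrite big1 ?mul0rn // => j _.
(* An exponent 2 + 2j(j+1) equal to 12n + 10 would give j(j+1) = 1 modulo 3, which no residue of j
   allows. *)
rewrite /= -exprS -exprM coefXn; case: eqP => // jm; exfalso.
move: (nat_of_ord j) jm => {}j jm; rewrite /m in jm.
have := divn_eq j 3; have : (j %% 3 < 3)%N by rewrite ltn_pmod.
by case: (j %% 3)%N => [|[|[|r]]] // _ jE; rewrite jE in jm; lia.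
Qed.

Local Close Scope ring_scope.

Theorem theorem1p2 (n : nat) : cphi 18 (6 * n + 5) = 0 %[mod 8].
Proof.
have := congr1 val (cphi18_Z8 n).
by rewrite /= val_Zp_nat.
Qed.
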